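(* Let $\alpha$ be an irrational real number and $N,r\ge1$ integers. Then $|D_r(S_\alpha(N))|\le 2r+1$, i.e. there are at most $2r+1$ distinct consecutive $r$--differences in $S_\alpha(N)$.
   Context: $\{x\}$ denotes the fractional part; $\mathbb{R}/\mathbb{Z}$ is identified with $[0,1)$ with its natural order. $S_\alpha(N)=\{\{n\alpha\}:1\le n\le N\}=\{a_1<\dots<a_N\}\subset\mathbb{R}/\mathbb{Z}$ (these are $N$ distinct points). Indices are taken cyclically, $a_{i+N}=a_i$, and differences are taken in $\mathbb{R}/\mathbb{Z}$. $D_r(S_\alpha(N))=\{(a_{i+1}-a_i,\dots,a_{i+r}-a_{i+r-1}):1\le i\le N\}$. *)

(* Defs.v *)
From mathcomp Require Import all_boot all_order all_algebra finmap.
From mathcomp Require Import reals.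

Set Implicit Arguments.
Unset Strict Implicit.
Unset Printing Implicit Defensive.

Import Order.TTheory GRing.Theory Num.Theory.

Local Open Scope fset_scope.
Local Open Scope ring_scope.

(* The representative in [0, 1) of the class of x in R/Z. *)
Definition fracpart (R : realType) (x : R) : R := x - (Num.floor x)%:~R.

Definition rotation_set (R : realType) (alpha : R) (N : nat) : {fset R} :=
  [fset fracpart (n%:R * alpha) | n in iota 1 N].

(* a_0 < ... < a_(N-1) is the increasing enumeration of S, N = #|` S|,
   numbered from 0 and extended N-periodically to all indices. *)
Definition cyclic_enum (R : realType) (S : {fset R}) (i : nat) : R :=
  nth 0 (sort <=%R (enum_fset S)) (i %% #|` S|)%N.

(* The r-tuple of differences, taken in R/Z, (a_(i+1) - a_i, ...,
   a_(i+r) - a_(i+r-1)). *)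
Definition consecutive_differences (R : realType) (S : {fset R}) (r i : nat) :
    r.-tuple R :=
  [tuple fracpart (cyclic_enum S (i + j).+1 - cyclic_enum S (i + j)%N) | j < r].

Definition difference_set (R : realType) (r : nat) (S : {fset R}) :
    {fset r.-tuple R} :=
  [fset consecutive_differences S r i | i in iota 0 #|` S|].

(* Main.v *)
(* Translation by alpha sends the arc carrying r consecutive differences and
   starting at {n alpha} to the one starting at {(n+1) alpha}, and it preserves
   the differences unless one of the r+1 points of the arc is {N alpha}, or 0
   (the preimage of {alpha}) lies in one of its r gaps. These exceptions concern
   at most (r+1) + r starting points. Iterating the translation, every starting
   point reaches an exceptional one without changing its r-difference. *)

Require Import Defs.
From mathcomp Require Import all_boot all_order all_algebra finmap.
From mathcomp Require Import reals.
From mathcomp Require Import zify lra.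

Set Implicit Arguments.
Unset Strict Implicit.
Unset Printing Implicit Defensive.

Import Order.TTheory GRing.Theory Num.Theory.

Local Open Scope fset_scope.
Local Open Scope ring_scope.

(** * Fractional parts as coordinates on the circle *)

Section FractionalPart.
Variable R : realType.
Implicit Types x y a : R.

Lemma fracpart_ge0 x : 0 <= fracpart x.
Proof. by rewrite /fracpart subr_ge0 floor_le. Qed.

Lemma fracpart_lt1 x : fracpart x < 1.
Proof. by have := floorD1_gt x; rewrite /fracpart intrD; lra. Qed.

Lemma fracpartDz x (m : int) : fracpart (x + m%:~R) = fracpart x.
Proof. by rewrite /fracpart floorDrz ?intr_int// intrKfloor intrD; lra. Qed.

Lemma fracpart_id x : 0 <= x < 1 -> fracpart x = x.
Proof. by move=> x01; rewrite /fracpart (floor_def (m := 0)) ?subr0. Qed.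

Lemma fracpart0 : fracpart (0 : R) = 0.
Proof. by rewrite fracpart_id ?lexx ?ltr01. Qed.

Lemma fracpart_neg x : -1 <= x < 0 -> fracpart x = x + 1.
Proof.
by move=> x10; rewrite -(fracpartDz x 1) fracpart_id//; move: x10; lra.
Qed.

Lemma fracpartB x y : fracpart (fracpart x - fracpart y) = fracpart (x - y).
Proof.
rewrite -[RHS](fracpartDz _ (Num.floor y - Num.floor x)) intrB.
by congr fracpart; rewrite /fracpart; lra.
Qed.

Lemma fracpartBr_inj a x y : 0 <= x < 1 -> 0 <= y < 1 ->
  fracpart (x - a) = fracpart (y - a) -> x = y.
Proof.
move=> x01 y01 eqxy; rewrite -(fracpart_id x01) -(fracpart_id y01).
(* Equality of the two fractional parts makes [x - y] exactly this difference of floors. *)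
rewrite -(fracpartDz y (Num.floor (x - a) - Num.floor (y - a))) intrB.
by congr fracpart; move: eqxy; rewrite /fracpart; lra.
Qed.

(** A coincidence would make [(n - m) * alpha] an integer, hence [alpha] rational. *)
Lemma fracpart_natmul_inj (alpha : R) : irrational alpha ->
  injective (fun n : nat => fracpart (n%:R * alpha)).
Proof.
move=> irr m n; wlog lt_mn : m n / (m < n)%N => [wlog_lt eqmn|].
  have [/wlog_lt -> //|/wlog_lt eqnm|//] := ltngtP m n.
  by rewrite eqnm.
move=> /= eqmn; case: irr; apply/rationalP.
exists (Num.floor (n%:R * alpha) - Num.floor (m%:R * alpha)), (n - m)%N.
rewrite intrB natrB ?(ltnW lt_mn)//.
have nm_neq0 : n%:R - m%:R != 0 :> R by rewrite subr_eq0 eqr_nat gtn_eqF.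
apply: (canRL (mulfK nm_neq0)); move: eqmn; rewrite /fracpart; lra.
Qed.

End FractionalPart.

(** * Successors in the cyclic order *)

Section CyclicEnumeration.
Variables (R : realType) (S : {fset R}).
Hypothesis S01 : forall x, x \in S -> 0 <= x < 1.

Let s := sort <=%R (enum_fset S).

Lemma size_sort_enum_fset : size s = #|` S|.
Proof. by rewrite size_sort. Qed.

Lemma cyclic_enum_in i : (0 < #|` S|)%N -> cyclic_enum S i \in S.
Proof.
move=> S_gt0; have: cyclic_enum S i \in s.
  by rewrite mem_nth// size_sort_enum_fset ltn_mod.
by rewrite mem_sort.
Qed.

Lemma cyclic_enum_mod i : cyclic_enum S (i %% #|` S|)%N = cyclic_enum S i.
Proof. by rewrite /cyclic_enum modn_mod. Qed.

Lemma cyclic_enum_modDl i j :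
  cyclic_enum S (i %% #|` S| + j)%N = cyclic_enum S (i + j)%N.
Proof. by rewrite /cyclic_enum modnDml. Qed.

Lemma cyclic_enum_onto x : x \in S ->
  exists2 i, (i < #|` S|)%N & cyclic_enum S i = x.
Proof.
rewrite -(mem_sort <=%R) -/s => xs; exists (index x s).
  by rewrite -size_sort_enum_fset index_mem.
by rewrite /cyclic_enum modn_small ?nth_index// -size_sort_enum_fset index_mem.
Qed.

Lemma cyclic_enum_lt i j : (i < #|` S|)%N -> (j < #|` S|)%N ->
  (cyclic_enum S i < cyclic_enum S j) = (i < j)%N.
Proof.
move=> iS jS; rewrite /cyclic_enum !modn_small//.
by rewrite lt_sorted_ltn_nth ?inE ?size_sort// sort_lt_sorted fset_uniq.
Qed.

Lemma cyclic_enum_le i j : (i < #|` S|)%N -> (j < #|` S|)%N ->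
  (cyclic_enum S i <= cyclic_enum S j) = (i <= j)%N.
Proof. by move=> iS jS; rewrite leNgt cyclic_enum_lt// -leqNgt. Qed.

Lemma cyclic_enum_inj i j : (i < #|` S|)%N -> (j < #|` S|)%N ->
  cyclic_enum S i = cyclic_enum S j -> i = j.
Proof.
move=> iS jS eqij; apply/eqP; rewrite eqn_leq.
by rewrite -(cyclic_enum_le iS jS) -(cyclic_enum_le jS iS) eqij lexx.
Qed.

(** Points above [cyclic_enum S i] are compared by their order in [0, 1); a point below it is
    reached only after passing 0, which adds 1 to its difference. *)
Lemma cyclic_enum_succ_le i x : x \in S -> x != cyclic_enum S i ->
  fracpart (cyclic_enum S i.+1 - cyclic_enum S i)
    <= fracpart (x - cyclic_enum S i).
Proof.
move=> xS; have [k kS kx] := cyclic_enum_onto xS.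
have S_gt0 : (0 < #|` S|)%N by apply: leq_ltn_trans kS.
rewrite -(cyclic_enum_mod i) -addn1 -(cyclic_enum_modDl i) addn1.
have: (i %% #|` S| < #|` S|)%N by rewrite ltn_mod.
move: (i %% _)%N => {}i iS; rewrite -{}kx => neq_ki.
have {}neq_ki : k != i by apply: contraNneq neq_ki => ->.
have a01 j : 0 <= cyclic_enum S j < 1 by rewrite S01 ?cyclic_enum_in.
have := (a01 i, a01 k, a01 i.+1).
have [iS1|] := ltnP i.+1 #|` S|.
  have : cyclic_enum S i < cyclic_enum S i.+1 by rewrite cyclic_enum_lt.
  case: (ltngtP k i) neq_ki => // [lt_ki|lt_ik] _.
    have : cyclic_enum S k < cyclic_enum S i by rewrite cyclic_enum_lt.
    move=> ? ? [[? ?] ?]; rewrite fracpart_id ?fracpart_neg; lra.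
  have : cyclic_enum S i.+1 <= cyclic_enum S k by rewrite cyclic_enum_le.
  move=> ? ? [[? ?] ?]; rewrite !fracpart_id; lra.
(* From the last index the successor is the point of index 0: both differences pass 0 and gain 1, so
   minimality of that point suffices. *)
move=> leSi; have eqi : i.+1 = #|` S| by apply/eqP; rewrite eqn_leq iS leSi.
have lt_ki : (k < i)%N by rewrite ltn_neqAle neq_ki -ltnS eqi.
have -> : cyclic_enum S i.+1 = cyclic_enum S 0.
  by rewrite eqi /cyclic_enum modnn mod0n.
have : cyclic_enum S 0 <= cyclic_enum S k by rewrite cyclic_enum_le.
have : cyclic_enum S k < cyclic_enum S i by rewrite cyclic_enum_lt.
move=> ? ? [[? ?] ?]; have := a01 0%N => ?.
rewrite !fracpart_neg; lra.
Qed.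

Lemma cyclic_enum_succ_neq i : (1 < #|` S|)%N ->
  cyclic_enum S i.+1 != cyclic_enum S i.
Proof.
move=> S_gt1; have S_gt0 := ltnW S_gt1; apply/eqP.
rewrite -(cyclic_enum_mod i) -(cyclic_enum_mod i.+1) => /cyclic_enum_inj.
rewrite !ltn_mod S_gt0 => /(_ isT isT)/eqP.
by rewrite -addn1 -[X in _ == X %[mod _]]addn0 eqn_modDl mod0n modn_small.
Qed.

(** Recognizes the successor by distances alone, so that it can be transported by a translation that
    does not respect indices. *)
Lemma cyclic_enum_succ_unique i x : (1 < #|` S|)%N ->
  x \in S -> x != cyclic_enum S i ->
  (forall y, y \in S -> y != cyclic_enum S i ->
     fracpart (x - cyclic_enum S i) <= fracpart (y - cyclic_enum S i)) ->
  cyclic_enum S i.+1 = x.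
Proof.
move=> S_gt1 xS neq_xi xmin; have S_gt0 := ltnW S_gt1.
apply: (@fracpartBr_inj _ (cyclic_enum S i)); rewrite ?S01 ?cyclic_enum_in//.
by apply/le_anti; rewrite cyclic_enum_succ_le//= xmin ?cyclic_enum_in//
  cyclic_enum_succ_neq.
Qed.

End CyclicEnumeration.

(** * Translation by [alpha] along the orbit *)

Section Rotation.
Variables (R : realType) (alpha : R) (N : nat).
Hypothesis irr : irrational alpha.

Let S := rotation_set alpha N.
Let f n := fracpart (n%:R * alpha).

Lemma rotation_setP x :
  reflect (exists2 n, (1 <= n <= N)%N & x = f n) (x \in S).
Proof.
apply: (iffP (imfsetP _ _ _ _)) => -[n /= nN ->]; exists n => //.
  by move: nN; rewrite mem_iota; lia.
by rewrite mem_iota; lia.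
Qed.

Lemma rotation_set01 x : x \in S -> 0 <= x < 1.
Proof. by case/rotation_setP => n _ ->; rewrite fracpart_ge0 fracpart_lt1. Qed.

Lemma card_rotation_set : #|` S| = N.
Proof.
rewrite card_imfset/=; last exact: fracpart_natmul_inj.
by rewrite undup_id ?iota_uniq ?size_iota.
Qed.

Lemma fracpart_shift m n : fracpart (f m.+1 - f n.+1) = fracpart (f m - f n).
Proof. by rewrite !fracpartB; congr fracpart; rewrite !mulrSr; lra. Qed.

(* A point inside the arc from f n.+1 to f m.+1 would shift back inside the arc
   from f n to f m, unless it is f 1, whose preimage 0 lies only in the arc from
   the last point to the first. *)
Lemma cyclic_enum_shift i k m n : (i %% N).+1 != N ->
  (n < N)%N -> (m < N)%N -> cyclic_enum S i = f n -> cyclic_enum S i.+1 = f m ->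
  cyclic_enum S k = f n.+1 -> cyclic_enum S k.+1 = f m.+1.
Proof.
move=> iN nN mN an am ak.
have injf : injective f := fracpart_natmul_inj irr.
have f0 : f 0 = 0 by rewrite /f mul0r fracpart0.
(* For [N = 1] the only index is the last one, which is excluded. *)
have S_gt1 : (1 < #|` S|)%N.
  rewrite card_rotation_set; case: N iN nN => [|[|]]//.
  by rewrite modn1.
have S_gt0 := ltnW S_gt1.
have neq_mn : f m != f n.
  by rewrite -am -an cyclic_enum_succ_neq.
(* As [i] is not the last index modulo [N], its gap does not contain 0. *)
have lt_nm : f n < f m.
  rewrite -am -an -(cyclic_enum_mod S i) -addn1 -(cyclic_enum_modDl S i) addn1.
  have : (i %% N < N)%N by rewrite ltn_mod; lia.
  by move=> ?; rewrite cyclic_enum_lt card_rotation_set//; lia.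
have eq_f p q : (f p == f q) = (p == q) by rewrite (inj_eq injf).
have n_gt0 : 0 < f n.
  have : cyclic_enum S i \in S by apply: cyclic_enum_in.
  rewrite an lt_neqAle fracpart_ge0 andbT => /rotation_setP[p p1 /injf eqpn].
  by rewrite -f0 eq_f; lia.
apply: cyclic_enum_succ_unique => //; first exact: rotation_set01.
- by apply/rotation_setP; exists m.+1.
- by rewrite ak eq_f eqSS -eq_f.
rewrite ak => y /rotation_setP[[//|[|p]] pN ->{y}];
  rewrite eq_f eqSS => neq_pn; rewrite !fracpart_shift.
  (* Here [y] is [f 1]: its preimage 0 is at distance [1 - f n] from [f n], which exceeds
     [f m - f n]. *)
  rewrite f0.
  have := fracpart_lt1 (m%:R * alpha); rewrite -/(f m).
  have := fracpart_lt1 (n%:R * alpha); rewrite -/(f n) => ? ?.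
  rewrite fracpart_id ?fracpart_neg; lra.
rewrite -am -an; apply: cyclic_enum_succ_le.
- exact: rotation_set01.
- by apply/rotation_setP; exists p.+1 => //; lia.
- by rewrite an eq_f.
Qed.

(* The obstructions to translating the arc from a_i to a_(i+r) by alpha: it
   carries the last point f N, or it has 0 in its interior. *)
Definition resonant r i :=
  has (fun j => cyclic_enum S (i + j)%N == f N) (iota 0 r.+1)
  || has (fun j => ((i + j) %% N).+1 == N)%N (iota 0 r).

Lemma cyclic_enum_rotation i : (0 < N)%N ->
  exists2 n, (1 <= n <= N)%N & cyclic_enum S i = f n.
Proof.
by move=> N_gt0; apply/rotation_setP/cyclic_enum_in; rewrite card_rotation_set.
Qed.

Lemma consecutive_differences_shift r i k n : (0 < N)%N -> ~~ resonant r i ->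
  cyclic_enum S i = f n -> cyclic_enum S k = f n.+1 ->
  consecutive_differences S r i = consecutive_differences S r k.
Proof.
move=> N_gt0; rewrite negb_or => /andP[/hasPn notN /hasPn notlast] an ak.
have injf : injective f := fracpart_natmul_inj irr.
(* By induction along the arc, the two arcs correspond point by point under the translation; no
   label [m] met here is [N], so each translate stays in [S]. *)
have shift j : (j <= r)%N -> exists m,
    cyclic_enum S (i + j)%N = f m /\ cyclic_enum S (k + j)%N = f m.+1.
  elim: j => [_|j IHj jr]; first by exists n; rewrite !addn0.
  have [m [am akm]] := IHj (ltnW jr).
  have [p pN ap] := cyclic_enum_rotation (i + j.+1)%N N_gt0.
  have [q qN aq] := cyclic_enum_rotation (i + j)%N N_gt0.
  have eqqm : q = m by apply: injf; rewrite -aq am.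
  have neq_mN : m != N.
    by rewrite -(inj_eq injf) -am; apply: notN; rewrite mem_iota; lia.
  have neq_pN : p != N.
    by rewrite -(inj_eq injf) -ap; apply: notN; rewrite mem_iota; lia.
  exists p; split=> //; rewrite addnS.
  apply: (@cyclic_enum_shift (i + j) _ _ m) => //; try lia.
    by apply: notlast; rewrite mem_iota; lia.
  by rewrite -addnS.
apply: eq_from_tnth => j; rewrite !tnth_mktuple.
have [m [am akm]] := shift _ (ltnW (ltn_ord j)).
have [p [ap akp]] := shift _ (ltn_ord j).
by rewrite -!addnS am akm ap akp fracpart_shift.
Qed.

(** Each translation raises the label [n] of the starting point by one, and an arc starting at [f N]
    is resonant, so induction on [N - n] applies. *)
Lemma consecutive_differences_resonant r i : (0 < N)%N ->
  exists2 k, resonant r k &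
    consecutive_differences S r i = consecutive_differences S r k.
Proof.
move=> N_gt0; have [n nN an] := cyclic_enum_rotation i N_gt0.
have [d dE] := ubnP (N - n)%N; elim: d n i dE nN an => // d IHd n i dE nN an.
have [res_i|nres_i] := boolP (resonant r i); first by exists i.
have neq_nN : n != N.
  apply: contraNneq nres_i => eq_nN; apply/orP; left; apply/hasP.
  by exists 0%N; rewrite // addn0 an eq_nN.
have /(cyclic_enum_onto (S := S))[k _ ak] : f n.+1 \in S.
  by apply/rotation_setP; exists n.+1 => //; lia.
rewrite (consecutive_differences_shift N_gt0 nres_i an ak).
by apply: (IHd n.+1) => //; lia.
Qed.

End Rotation.

(** * Counting resonant indices modulo [N] *)

Lemma consecutive_differences_mod (R : realType) (S : {fset R}) r i :
  consecutive_differences S r (i %% #|` S|)%N = consecutive_differences S r i.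
Proof.
by apply: eq_from_tnth => j; rewrite !tnth_mktuple -!addnS !cyclic_enum_modDl.
Qed.

(** The natural number [N - j %% N] plays the role of [-j] modulo [N]. *)
Lemma modnD_solve N i j c : (0 < N)%N -> (i + j = c %[mod N])%N ->
  (i = c + (N - j %% N) %[mod N])%N.
Proof.
move=> N_gt0 eqc; rewrite -modnDml -eqc modnDml.
have -> : (i + j + (N - j %% N) = i + (j %/ N).+1 * N)%N.
  by have := divn_eq j N; have := ltn_pmod j N_gt0; lia.
by rewrite addnC modnMDl.
Qed.

Theorem theorem1p5 (R : realType) (alpha : R) (N r : nat)
    (halpha : irrational alpha) (hN : (1 <= N)%N) (hr : (1 <= r)%N) :
  (#|` difference_set r (rotation_set alpha N)| <= 2 * r + 1)%N.
Proof.
have cardS := card_rotation_set N halpha.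
set S := rotation_set alpha N in cardS *.
have /(cyclic_enum_onto (S := S))[c cN ac] : fracpart (N%:R * alpha) \in S.
  by apply/rotation_setP; exists N => //; lia.
pose pred_mod d j := ((d + (N - j %% N)) %% N)%N.
(* With [c] the index of [f N], these are the indices [c - j] and [N - 1 - j] modulo [N], one for
   each way of being resonant; repetitions are harmless for an upper bound. *)
pose L := [seq pred_mod c j | j <- iota 0 r.+1]
          ++ [seq pred_mod N.-1 j | j <- iota 0 r].
have sizeL : size L = (2 * r + 1)%N.
  by rewrite size_cat !size_map !size_iota; lia.
have : difference_set r S `<=` [fset consecutive_differences S r i | i in L].
  apply/fsubsetP => _ /imfsetP[i /= _ ->].
  have [k res_k ->] := consecutive_differences_resonant halpha r i hN.
  apply/imfsetP; exists (k %% N)%N; last first.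
    by rewrite -[X in (_ %% X)%N]cardS consecutive_differences_mod.
  rewrite /= mem_cat; case/orP: res_k => /hasP[j j_r /eqP kj].
    apply/orP; left; apply/mapP; exists j => //; apply: modnD_solve => //.
    rewrite -cardS; apply: (@cyclic_enum_inj _ S); rewrite ?ltn_mod ?cardS//.
    by rewrite -cardS !cyclic_enum_mod kj ac.
  apply/orP; right; apply/mapP; exists j => //; apply: modnD_solve => //.
  by rewrite (@modn_small N.-1); lia.
move=> /fsubset_leq_card/leq_trans; apply.
apply: leq_trans (leq_imfset_card _ _ _) _; rewrite -sizeL.
exact: size_undup.
Qed.
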